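(* Let $\Sigma$ be the continuous-time control-affine system $\dot x=f(x)+Gu$, $y=h(x)+Ju$ described in the context, with set of assignable equilibria $\mathcal{E}_\Sigma$, and let $\mathsf{w}$ be the quadratic supply rate with parameters $(Q,S,R)$ described in the context. Let $V:\mathcal{X}\to\mathbb{R}_{\ge 0}$ be continuously differentiable and convex, and for $\bar x\in\mathcal{E}_\Sigma$ let $$V_{\bar x}(x):=V(x)-V(\bar x)-\nabla V(\bar x)^{\mathsf T}(x-\bar x).$$ Then $\Sigma$ is EID with respect to $\mathsf{w}$ with storage function family $\{V_{\bar x}(x),\ \bar x\in\mathcal{E}_\Sigma\}$ if and only if there exist an integer $k>0$, a matrix $W\in\mathbb{R}^{k\times m}$, and a function $\ell:\mathcal{X}\times\mathcal{X}\to\mathbb{R}^k$ such that $$[\nabla V(x)-\nabla V(\bar x)]^{\mathsf T}[f(x)-f(\bar x)]=[h(x)-h(\bar x)]^{\mathsf T}Q[h(x)-h(\bar x)]-\|\ell(x,\bar x)\|_2^2,$$ $$\tfrac12[\nabla V(x)-\nabla V(\bar x)]^{\mathsf T}G=[h(x)-h(\bar x)]^{\mathsf T}(QJ+S)-\ell(x,\bar x)^{\mathsf T}W,$$ $$W^{\mathsf T}W=R+J^{\mathsf T}S+S^{\mathsf T}J+J^{\mathsf T}QJ$$ for all $(x,\bar x)\in\mathcal{X}\times\mathcal{E}_\Sigma$. Moreover, the function $\ell$ in these equations may always be chosen to have the form $$\ell(x,\bar x)=l(x)-l(\bar x)+T\,q(x,\bar x),$$ where $l:\mathcal{X}\to\mathbb{R}^k$,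 the columns of $T\in\mathbb{R}^{k\times r}$ with $r=\dim(\ker(W^{\mathsf T}))$ form a basis of $\ker(W^{\mathsf T})$, and $q:\mathcal{X}\times\mathcal{X}\to\mathbb{R}^r$ satisfies $q(x,x)=0$ for all $x\in\mathcal{X}$.
   Context: System: $\dot x(t)=f(x(t))+Gu(t)$, $y(t)=h(x(t))+Ju(t)$, with $x(t)\in\mathcal{X}=\mathbb{R}^n$, $u(t)\in\mathcal{U}=\mathbb{R}^m$, $y(t)\in\mathcal{Y}=\mathbb{R}^p$, $m,p\le n$. The maps $f:\mathcal{X}\to\mathbb{R}^n$, $h:\mathcal{X}\to\mathcal{Y}$ are sufficiently smooth that trajectories are forward complete for all initial conditions and all inputs $u(\cdot)\in\mathscr{L}_{2e}^m[0,\infty)$ (locally square-integrable inputs), with outputs in $\mathscr{L}_{2e}^p[0,\infty)$. $G\in\mathbb{R}^{n\times m}$ is constant with rank $m$; $J\in\mathbb{R}^{p\times m}$ is constant. Equilibria: $\mathcal{E}_\Sigma=\{\bar x\in\mathcal{X}: \exists\,\bar u\in\mathcal{U},\ f(\bar x)+G\bar u=0\}$ (equivalently $\mathcal{X}$ if $m=n$, and $\{\bar x: G^\perp f(\bar x)=0\}$ if $m<n$, where $G^\perp\in\mathbb{R}^{(n-m)\times n}$ has rank $n-m$ and $G^\perp G=0$). For $\bar x\in\mathcal{E}_\Sigma$ the unique equilibrium input and output are $\bar u=k_u(\bar x):=-(G^{\mathsf T}G)^{-1}G^{\mathsf T}f(\bar x)$ and $\bar y=k_y(\bar x):=h(\bar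 x)+J k_u(\bar x)$. Supply rate: $\mathsf{w}(u,y)=\begin{bmatrix} y \\ u \end{bmatrix}^{\mathsf T}\begin{bmatrix} Q & S \\ S^{\mathsf T} & R \end{bmatrix}\begin{bmatrix} y \\ u \end{bmatrix}$ with $Q=Q^{\mathsf T}\in\mathbb{R}^{p\times p}$, $S\in\mathbb{R}^{p\times m}$, $R=R^{\mathsf T}\in\mathbb{R}^{m\times m}$, the block matrix being sign-indefinite. EID (equilibrium-independent dissipative) with supply rate $\mathsf{w}$ and storage function family $\{V_{\bar x},\ \bar x\in\mathcal{E}_\Sigma\}$: for every $\bar x\in\mathcal{E}_\Sigma$, with $\bar u=k_u(\bar x)$, $\bar y=k_y(\bar x)$, the function $V_{\bar x}:\mathcal{X}\to\mathbb{R}_{\ge0}$ is continuously differentiable, $V_{\bar x}(\bar x)=0$, and $\frac{d}{dt}V_{\bar x}(x(t)):=\nabla V_{\bar x}(x)^{\mathsf T}(f(x)+Gu)\le\mathsf{w}(u-\bar u,y-\bar y)$ for all $t\ge0$, along all trajectories (all initial conditions, all measurable inputs $u(\cdot)\in\mathscr{L}_{2e}^m[0,\infty)$); equivalently, pointwise for all $x\in\mathcal{X}$, $u\in\mathcal{U}$ with $y=h(x)+Ju$. *)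

(* Defs.v *)
From HB Require Import structures.
From mathcomp Require Import all_boot all_order all_algebra.
From mathcomp Require Import all_classical all_reals all_analysis.
Import Order.TTheory GRing.Theory Num.Theory.
Import numFieldNormedType.Exports.

Set Implicit Arguments.
Unset Strict Implicit.
Unset Printing Implicit Defensive.

Local Open Scope classical_set_scope.
Local Open Scope ring_scope.

(* Vectors of R^n are column vectors 'cV[R]_n. The library norm `|v| of a
   matrix is the sup norm, so the Euclidean norm is defined here. *)

Definition dot (R : realType) (n : nat) (u v : 'cV[R]_n) : R :=
  (u^T *m v) 0 0.

Definition sqnorm2 (R : realType) (n : nat) (v : 'cV[R]_n) : R := dot v v.

Definition quad (R : realType) (n : nat) (M : 'M[R]_n) (z : 'cV[R]_n) : R :=
  (z^T *m M *m z) 0 0.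

Definition gradient (R : realType) (n : nat) (F : 'cV[R]_n -> R)
    (x : 'cV[R]_n) : 'cV[R]_n :=
  \col_(i < n) 'D_(delta_mx i 0) F x.

Definition continuously_differentiable (R : realType) (n : nat)
    (F : 'cV[R]_n -> R) : Prop :=
  (forall x, differentiable F x) /\ continuous (gradient F).

(* xdot = drift x + inmx u,  y = outmap x + feedmx u *)
Record affine_system (R : realType) (n m p : nat) := AffineSystem {
  drift : 'cV[R]_n -> 'cV[R]_n ;
  inmx : 'M[R]_(n, m) ;
  outmap : 'cV[R]_n -> 'cV[R]_p ;
  feedmx : 'M[R]_(p, m) }.

(* Signals are functions on R of which only the values at t >= 0 matter. *)
Definition L2e (R : realType) (d : nat) (u : R -> 'cV[R]_d) : Prop :=
  (forall i : 'I_d, measurable_fun (`[0, +oo[ : set R) (fun t : R => u t i 0)) /\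
  (forall t1 : R, 0 <= t1 ->
    (\int[lebesgue_measure]_(t in `[0%R, t1]) (sqnorm2 (u t))%:E < +oo)%E).

Section System.
Variables (R : realType) (n m p : nat) (Sg : affine_system R n m p).

Definition vfield (x : 'cV[R]_n) (u : 'cV[R]_m) : 'cV[R]_n :=
  drift Sg x + inmx Sg *m u.

Definition output (x : 'cV[R]_n) (u : 'cV[R]_m) : 'cV[R]_p :=
  outmap Sg x + feedmx Sg *m u.

(* Caratheodory solution on [0, +oo[: inputs are only measurable, so the
   differential equation is stated in integral form. *)
Definition is_trajectory (u : R -> 'cV[R]_m) (x : R -> 'cV[R]_n) : Prop :=
  forall (t : R) (i : 'I_n), 0 <= t ->
    lebesgue_measure.-integrable `[0, t]
      (fun s => (vfield (x s) (u s) i 0)%:E) /\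
    x t i 0 = x 0 i 0 +
      \int[lebesgue_measure]_(s in `[0, t]) (vfield (x s) (u s) i 0).

Definition forward_complete : Prop :=
  forall (x0 : 'cV[R]_n) (u : R -> 'cV[R]_m), L2e u ->
    exists x, is_trajectory u x /\ x 0 = x0.

Definition outputs_L2e : Prop :=
  forall (u : R -> 'cV[R]_m) (x : R -> 'cV[R]_n), L2e u ->
    is_trajectory u x -> L2e (fun t => output (x t) (u t)).

Definition standing_assumptions : Prop :=
  [/\ (m <= n)%N, (p <= n)%N, \rank (inmx Sg) = m,
      continuous (drift Sg) /\ continuous (outmap Sg)
    & forward_complete /\ outputs_L2e].

Definition equilibria : set 'cV[R]_n :=
  [set xb | exists ub : 'cV[R]_m, drift Sg xb + inmx Sg *m ub = 0].

Definition k_u (xb : 'cV[R]_n) : 'cV[R]_m :=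
  - (invmx ((inmx Sg)^T *m inmx Sg) *m (inmx Sg)^T *m drift Sg xb).

Definition k_y (xb : 'cV[R]_n) : 'cV[R]_p :=
  outmap Sg xb + feedmx Sg *m k_u xb.

Definition supply_mx (Q : 'M[R]_p) (S : 'M[R]_(p, m)) (Rm : 'M[R]_m) :
    'M[R]_(p + m) :=
  block_mx Q S S^T Rm.

Definition sign_indefinite (d : nat) (M : 'M[R]_d) : Prop :=
  (exists z, 0 < quad M z) /\ (exists z, quad M z < 0).

Definition supply (Q : 'M[R]_p) (S : 'M[R]_(p, m)) (Rm : 'M[R]_m)
    (u : 'cV[R]_m) (y : 'cV[R]_p) : R :=
  quad (supply_mx Q S Rm) (col_mx y u).

(* Equilibrium-independent dissipativity. The derivative of Vf xb along a
   trajectory is by definition the inner product of its gradient with the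
   vector field, so it makes sense at every t >= 0, not only where x is
   differentiable. *)
Definition EID (w : 'cV[R]_m -> 'cV[R]_p -> R)
    (Vf : 'cV[R]_n -> 'cV[R]_n -> R) : Prop :=
  forall xb, equilibria xb ->
  [/\ forall x, 0 <= Vf xb x,
      continuously_differentiable (Vf xb),
      Vf xb xb = 0
    & forall (u : R -> 'cV[R]_m) (x : R -> 'cV[R]_n),
        L2e u -> is_trajectory u x -> forall t : R, 0 <= t ->
        dot (gradient (Vf xb) (x t)) (vfield (x t) (u t))
          <= w (u t - k_u xb) (output (x t) (u t) - k_y xb)].

(* All three equations are quantified over
   (x, xb) in R^n x equilibria: if there is no equilibrium, nothing is
   required, not even of W. *)
Definition EID_equations (Q : 'M[R]_p) (S : 'M[R]_(p, m)) (Rm : 'M[R]_m)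
    (V : 'cV[R]_n -> R) (k : nat) (W : 'M[R]_(k, m))
    (ell : 'cV[R]_n -> 'cV[R]_n -> 'cV[R]_k) : Prop :=
  let f := drift Sg in let G := inmx Sg in
  let h := outmap Sg in let J := feedmx Sg in
  forall x xb, equilibria xb ->
  [/\ dot (gradient V x - gradient V xb) (f x - f xb) =
        quad Q (h x - h xb) - sqnorm2 (ell x xb),
      2^-1 *: ((gradient V x - gradient V xb)^T *m G) =
        (h x - h xb)^T *m (Q *m J + S) - (ell x xb)^T *m W
    & W^T *m W = Rm + J^T *m S + S^T *m J + J^T *m Q *m J].

End System.

Definition bregman (R : realType) (n : nat) (V : 'cV[R]_n -> R)
    (xb x : 'cV[R]_n) : R :=
  V x - V xb - dot (gradient V xb) (x - xb).

Definition ker_trmx (R : realType) (k m : nat) (W : 'M[R]_(k, m)) :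
    {vspace 'cV[R]_k} :=
  lker (linfun (mulmx W^T)).

Definition columns_basis (R : realType) (k r : nat) (U : {vspace 'cV[R]_k})
    (T : 'M[R]_(k, r)) : Prop :=
  basis_of U [seq col j T | j <- enum 'I_r].

(* Main.v *)
Require Import Defs.
From HB Require Import structures.
From mathcomp Require Import all_boot all_order all_algebra.
From mathcomp Require Import ring lra.
From mathcomp Require Import all_classical all_reals all_analysis.
Import Order.TTheory GRing.Theory Num.Theory.
Import numFieldNormedType.Exports.

Set Implicit Arguments.
Unset Strict Implicit.
Unset Printing Implicit Defensive.

Local Open Scope classical_set_scope.
Local Open Scope ring_scope.

(* At an equilibrium xb, putting v = u - k_u(xb) turns the supply rate minus the
   storage derivative into a quadratic polynomial a + 2 b^T v + v^T M v, with
   a, b depending on (x, xb) and M constant. Constant inputs reach every pair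
   (x, u) at t = 0, so dissipativity says that this polynomial is nonnegative
   for all x, xb, v. The three equations say that it equals |ell + W v|^2.
   Conversely, nonnegativity gives M = W0^T W0 and b = M z with b^T z <= a; one
   takes W = [W0; 0], ell = [W0 z; sqrt (a - b^T z)]. *)

(** * Inner product, quadratic forms and their factorization *)

Section Dot.
Context {R : realType}.

Lemma dotE n (u v : 'cV[R]_n) : dot u v = \sum_i u i 0 * v i 0.
Proof. by rewrite /dot mxE; apply: eq_bigr => i _; rewrite mxE. Qed.

Lemma dotC n (u v : 'cV[R]_n) : dot u v = dot v u.
Proof. by rewrite !dotE; apply: eq_bigr => i _; rewrite mulrC. Qed.

Lemma dotDr n (u v w : 'cV[R]_n) : dot u (v + w) = dot u v + dot u w.
Proof. by rewrite /dot mulmxDr mxE. Qed.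

Lemma dotDl n (u v w : 'cV[R]_n) : dot (u + v) w = dot u w + dot v w.
Proof. by rewrite dotC dotDr !(dotC w). Qed.

Lemma dotZr n a (u v : 'cV[R]_n) : dot u (a *: v) = a * dot u v.
Proof. by rewrite /dot -scalemxAr mxE. Qed.

Lemma dotZl n a (u v : 'cV[R]_n) : dot (a *: u) v = a * dot u v.
Proof. by rewrite dotC dotZr dotC. Qed.

Lemma dotNr n (u v : 'cV[R]_n) : dot u (- v) = - dot u v.
Proof. by rewrite -scaleN1r dotZr mulN1r. Qed.

Lemma dotNl n (u v : 'cV[R]_n) : dot (- u) v = - dot u v.
Proof. by rewrite dotC dotNr dotC. Qed.

Lemma dot0r n (u : 'cV[R]_n) : dot u 0 = 0.
Proof. by rewrite /dot mulmx0 mxE. Qed.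

Lemma dot0l n (u : 'cV[R]_n) : dot 0 u = 0.
Proof. by rewrite dotC dot0r. Qed.

Lemma dot_mulmxr n k (A : 'M[R]_(n, k)) u v : dot u (A *m v) = dot (A^T *m u) v.
Proof. by rewrite /dot trmx_mul trmxK mulmxA. Qed.

Lemma quadE n (M : 'M[R]_n) z : quad M z = dot z (M *m z).
Proof. by rewrite /quad /dot mulmxA. Qed.

Lemma quad_tr_mul n k (W : 'M[R]_(k, n)) v :
  quad (W^T *m W) v = sqnorm2 (W *m v).
Proof. by rewrite quadE -mulmxA dot_mulmxr trmxK. Qed.

Lemma sqnorm2_ge0 n (v : 'cV[R]_n) : 0 <= sqnorm2 v.
Proof. by rewrite /sqnorm2 dotE sumr_ge0// => i _; rewrite -expr2 sqr_ge0. Qed.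

Lemma sqnorm2_eq0 n (v : 'cV[R]_n) : (sqnorm2 v == 0) = (v == 0).
Proof.
apply/idP/eqP => [|->]; last by rewrite /sqnorm2 dot0r.
rewrite /sqnorm2 dotE psumr_eq0 => [/allP v0|i _]; last by rewrite -expr2 sqr_ge0.
apply/colP => i; rewrite mxE; apply/eqP.
by have := v0 i (mem_index_enum i); rewrite mulf_eq0 orbb.
Qed.

Lemma dot_col_mx n k (u1 v1 : 'cV[R]_n) (u2 v2 : 'cV[R]_k) :
  dot (col_mx u1 u2) (col_mx v1 v2) = dot u1 v1 + dot u2 v2.
Proof. by rewrite /dot tr_col_mx mul_row_col mxE. Qed.

(** If [A^T A v = 0] then [|A v|^2 = 0], and full column rank forces [v = 0]. *)
Lemma gram_unitmx n k (A : 'M[R]_(n, k)) : \rank A = k -> A^T *m A \in unitmx.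
Proof.
move=> rkA; rewrite -row_free_unit; apply/inj_row_free => v.
move=> /(congr1 trmx); rewrite !trmx_mul trmxK trmx0 => AAv0.
have Av0 : A *m v^T = 0.
  by apply/eqP; rewrite -sqnorm2_eq0 -quad_tr_mul quadE AAv0 dot0r.
have fA : row_free A^T by rewrite -row_leq_rank mxrank_tr rkA.
by apply: (row_free_inj fA); rewrite mul0mx -[v]trmxK -trmx_mul Av0 trmx0.
Qed.

Lemma quad_block n k (A : 'M[R]_n) B (D : 'M[R]_k) u v :
  quad (block_mx A B B^T D) (col_mx u v) =
  quad A u + 2 * dot u (B *m v) + quad D v.
Proof.
rewrite !quadE mul_block_col dot_col_mx !dotDr.
by rewrite [dot v (_ *m u)]dotC -dot_mulmxr; ring.
Qed.

Lemma affine_bounded_below (a c : R) : (forall t, 0 <= a + t * c) -> c = 0.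
Proof.
move=> h; apply/eqP/negP => /negP c0.
(* At this [t] the affine function takes the value [-1]. *)
have := h (- (a + 1) / c); rewrite -mulrA mulVf// mulr1; lra.
Qed.

(* The polynomial is affine along [ker M], so [b] is orthogonal to [ker M] and
   [M z = b] is solvable; the bound is its value at the minimizer [- z]. *)
Lemma quad_poly_ge0 n (M : 'M[R]_n) (a : R) (b : 'cV[R]_n) : M^T = M ->
  (forall v, 0 <= a + 2 * dot b v + quad M v) ->
  exists z, M *m z = b /\ dot b z <= a.
Proof.
move=> sM h.
have /submxP[z bz] : (b^T <= M)%MS.
  rewrite submxE; apply/eqP/rowP => j; rewrite [RHS]mxE.
  pose v := col j (cokermx M).
  have Mv : M *m v = 0 by rewrite /v colE mulmxA mulmx_coker mul0mx.
  have -> (C : 'M[R]_n) : (b^T *m C) 0 j = dot b (col j C).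
    by rewrite /dot !mxE; apply: eq_bigr => k _; rewrite !mxE.
  rewrite -/v; apply/eqP; rewrite -(mulrI_eq0 _ (mulfI (_ : 2 != 0)))//; apply/eqP.
  apply: (@affine_bounded_below a) => t; have := h (t *: v).
  by rewrite dotZr quadE -scalemxAr Mv scaler0 dot0r addr0 mulrCA.
exists z^T; have Mz : M *m z^T = b by rewrite -[b]trmxK bz trmx_mul sM.
split=> //; have := h (- z^T).
by rewrite dotNr quadE mulmxN Mz dotNr dotNl opprK (dotC _ b); lra.
Qed.

(** Cholesky factorization by induction on the size: the Schur complement of the top left entry is
    again positive semidefinite. *)
Lemma psd_factorization n (M : 'M[R]_n) : M^T = M ->
  (forall v, 0 <= quad M v) -> exists W : 'M[R]_n, W^T *m W = M.
Proof.
elim: n M => [|n IHn] M sM psdM; first by exists 0; apply/matrixP; case.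
pose A := (M : 'M[R]_(1 + n)).
have sA : A^T = A := sM.
have psdA z : 0 <= quad A z := psdM z.
pose a := A 0 0; pose b := ursubmx A; pose D := drsubmx A.
have blA : A = block_mx a%:M b b^T D.
  rewrite -[LHS]submxK; congr block_mx.
    by rewrite [LHS]mx11_scalar; congr _%:M; rewrite !mxE; congr (A _ _); apply/val_inj.
  by rewrite -[in LHS]sA trmx_ursub.
have sD : D^T = D by rewrite /D trmx_drsub sA.
have qA s v : quad A (col_mx (s%:M) v) = a * s ^+ 2 + 2 * s * (b *m v) 0 0 + quad D v.
  rewrite blA quad_block !quadE; congr (_ + _ + _).
    by rewrite mul_scalar_mx dotZr dotE big_ord1 !mxE expr2.
  by rewrite dotE big_ord1 [(_%:M) _ _]mxE eqxx mulr1n mulrA.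
have a0 : 0 <= a.
  by have := psdA (col_mx 1%:M 0); rewrite qA mulmx0 quadE mulmx0 dot0r !mxE; lra.
(* With [a = 0], the form at [(t/2, b^T)] is affine in [t] with slope [|b|^2], so nonnegativity
   kills the slope. *)
have ba0 : a = 0 -> b = 0.
  move=> aE; apply/trmx_inj/eqP; rewrite trmx0 -sqnorm2_eq0; apply/eqP.
  apply: (@affine_bounded_below (quad D b^T)) => t.
  have := psdA (col_mx (2^-1 * t)%:M b^T); rewrite qA aE /sqnorm2 {1}/dot trmxK; lra.
(* Schur complement; when [a = 0] also [b = 0], and [0^-1 = 0] makes the same
   formulas valid. *)
have [W WE] : exists W : 'M[R]_n, W^T *m W = D - a^-1 *: (b^T *m b).
  apply: IHn => [|v].
    by rewrite linearB/= linearZ/= trmx_mul trmxK sD.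
  have [aE|an0] := eqVneq a 0.
    have := psdA (col_mx 0%:M v).
    by rewrite qA ba0// mulmx0 scaler0 subr0 aE; lra.
  (* This first coordinate minimizes the form for fixed [v]; the minimum is the Schur complement
     evaluated at [v]. *)
  have := psdA (col_mx (- a^-1 * (b *m v) 0 0)%:M v); rewrite qA.
  rewrite !quadE mulmxBl dotDr dotNr -scalemxAl dotZr -mulmxA (@dot_mulmxr _ _ b^T) trmxK.
  rewrite [dot (b *m v) _]dotE big_ord1.
  suff -> : forall s e : R, a * (- a^-1 * s) ^+ 2 + 2 * (- a^-1 * s) * s + e =
    e - a^-1 * (s * s) by [].
  by move=> s e; field.
have sqa : Num.sqrt a * Num.sqrt a = a by rewrite -expr2 sqr_sqrtr.
pose W1 : 'M[R]_(1 + n) := block_mx (Num.sqrt a)%:M ((Num.sqrt a)^-1 *: b) 0 W.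
suff W1E : W1^T *m W1 = A by exists W1.
rewrite blA tr_block_mx mulmx_block !trmx0 !mul0mx !mulmx0 !addr0.
have sb : Num.sqrt a * (Num.sqrt a)^-1 *: b = b.
  have [aE|an0] := eqVneq a 0; first by rewrite ba0// scaler0.
  by rewrite divff ?scale1r// sqrtr_eq0 -ltNge lt_neqAle eq_sym an0.
congr block_mx.
- by rewrite tr_scalar_mx -scalar_mxM sqa.
- by rewrite tr_scalar_mx mul_scalar_mx scalerA sb.
- by rewrite mul_mx_scalar linearZ/= scalerA -linearZ/= sb.
rewrite WE -scalemxAr linearZ/= -scalemxAl scalerA -invfM sqa.
by rewrite addrC subrK.
Qed.

End Dot.

(** * Gradients and the Bregman divergence of a convex function *)

Section Bregman.
Context {R : realType} {n : nat}.
Implicit Types V : 'cV[R]_n -> R.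

Lemma dot_is_linear (g : 'cV[R]_n) : linear (dot g).
Proof. by move=> a u v; rewrite dotDr dotZr. Qed.

HB.instance Definition _ (g : 'cV[R]_n) :=
  GRing.isLinear.Build R 'cV[R]_n R *:%R (dot g) (dot_is_linear g).

Lemma differentiable_dot (g x : 'cV[R]_n) : differentiable (dot g) x.
Proof.
rewrite (_ : dot g = \sum_i (g i 0 *: fun x : 'cV[R]_n => x i 0)).
  by apply: differentiable_sum => i; exact/differentiableZ/differentiable_coord.
by apply/funext => y; rewrite dotE fct_sumE.
Qed.

Lemma dot_continuous (g : 'cV[R]_n) : continuous (dot g).
Proof. by move=> x; exact/differentiable_continuous/differentiable_dot. Qed.

Lemma derive_dot (g x v : 'cV[R]_n) : 'D_v (dot g) x = dot g v.
Proof.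
rewrite deriveE; last exact: differentiable_dot.
by rewrite diff_lin //; exact: dot_continuous.
Qed.

(** The differential is linear, so expanding [v] in the standard basis reduces it to partial
    derivatives. *)
Lemma derive_gradient V (x v : 'cV[R]_n) : differentiable V x ->
  'D_v V x = dot (gradient V x) v.
Proof.
move=> dV; rewrite deriveE// dotE.
have vE : v = \sum_i v i 0 *: delta_mx i 0.
  by rewrite [LHS]matrix_sum_delta; apply: eq_bigr => i _; rewrite big_ord1.
rewrite [in LHS]vE linear_sum; apply: eq_bigr => i _.
by rewrite linearZ/= mxE deriveE// mulrC.
Qed.

Lemma bregmanE V xb :
  bregman V xb = (V \- dot (gradient V xb)) \+
    cst (dot (gradient V xb) xb - V xb).
Proof. by apply/funext => x; rewrite /bregman dotDr dotNr/=; ring. Qed.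

Lemma gradient_bregman V xb x : differentiable V x ->
  gradient (bregman V xb) x = gradient V x - gradient V xb.
Proof.
move=> dV; apply/colP => i; rewrite !mxE bregmanE.
have d1 : derivable V x (delta_mx i 0) by exact: diff_derivable.
have d2 : derivable (dot (gradient V xb)) x (delta_mx i 0).
  exact/diff_derivable/differentiable_dot.
rewrite deriveD; [|exact: derivableB|exact: derivable_cst].
rewrite deriveB// derive_cst addr0 derive_dot; congr (_ - _).
by rewrite /dot -colE !mxE.
Qed.

Lemma bregman_continuously_differentiable V xb :
  continuously_differentiable V -> continuously_differentiable (bregman V xb).
Proof.
move=> [dV cV]; split=> [x|].
  rewrite bregmanE; apply: differentiableD; last exact: differentiable_cst.
  by apply: differentiableB => //; exact: differentiable_dot.
rewrite (_ : gradient _ = fun x => gradient V x - gradient V xb).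
  by move=> x; apply: continuousB; [exact: cV|exact: cst_continuous].
by apply/funext => x; exact: gradient_bregman.
Qed.

(** A convex function lies above its tangent plane: the difference quotients from [xb] towards [x]
    are at most [V x - V xb]. *)
Lemma bregman_ge0 V xb x : differentiable V xb ->
  convex_function [set: convex_lmodType 'cV[R]_n] V -> 0 <= bregman V xb x.
Proof.
move=> dV cvxV; rewrite /bregman -derive_gradient// subr_ge0.
have dr : derivable V xb (x - xb) by exact: diff_derivable.
(* Convexity controls the quotient only for [t] in []0, 1]], so the derivative is computed as a
   limit from the right. *)
rewrite /derive cvg_at_rightE//; apply: limr_le.
  apply: cvgP; apply: (cvg_trans _ dr); apply: cvg_app => A [e e0 Ae].
  by exists e => // y ye y0; apply: Ae => //; exact/lt0r_neq0.
near=> t.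
have t0 : 0 < t by [].
have t1 : t <= 1 by near: t; apply: nbhs_right_le.
have Vt : V (t *: (x - xb) + xb) <= t * V x + (1 - t) * V xb.
  rewrite scalerBr -addrA (_ : - _ + xb = (1 - t) *: xb).
    by have := @cvxV (Itv01 (ltW t0) t1) x xb; rewrite !inE => /(_ I I).
  by rewrite scalerBl scale1r addrC.
rewrite -[_ *: _]/(_ * _) ler_pdivrMl//= /shift/=; lra.
Unshelve. all: by end_near. Qed.

End Bregman.

(** * Matrices of basis columns, and constant inputs *)

Lemma columns_basis_exists {R : realType} {k : nat} (U : {vspace 'cV[R]_k}) :
  exists T : 'M[R]_(k, \dim U), columns_basis U T.
Proof.
exists (\matrix_(i, j) tnth (vbasis U) j i 0); rewrite /columns_basis.
rewrite (_ : [seq _ | _ <- _] = vbasis U); first exact: vbasisP.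
rewrite -[RHS]map_tnth_enum; apply: eq_map => j.
by apply/colP => i; rewrite !mxE.
Qed.

Lemma columns_basis_mulP {R : realType} {k r : nat} (U : {vspace 'cV[R]_k})
    (T : 'M[R]_(k, r)) (v : 'cV[R]_k) :
  columns_basis U T -> v \in U -> exists c : 'cV[R]_r, v = T *m c.
Proof.
pose X := map_tuple (fun j => col j T) (ord_tuple r).
move=> bT /(@coord_basis _ _ U r X v bT) vE; exists (\col_i coord X i v).
rewrite {1}vE; apply/colP => i; rewrite summxE mxE; apply: eq_bigr => j _.
by rewrite -tnth_nth tnth_map tnth_ord_tuple !mxE mulrC.
Qed.

Lemma L2e_cst {R : realType} {d : nat} (u0 : 'cV[R]_d) : L2e (fun=> u0).
Proof.
split=> [i|t1 t10]; first exact: measurable_cst.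
rewrite (integral_cst _ _ (sqnorm2 u0)%:E)//.
rewrite [X in (_ * X)%E]lebesgue_measure_itv/=.
by case: ifP => _; rewrite ?mule0// -EFinD -EFinM ltry.
Qed.

(** * The dissipation gap and the three equations *)

Section Dissipativity.
Context {R : realType} {n m p : nat} (Sg : affine_system R n m p).
Hypothesis hSg : standing_assumptions Sg.
Context (Q : 'M[R]_p) (S : 'M[R]_(p, m)) (Rm : 'M[R]_m).
Hypotheses (hQ : Q^T = Q) (hR : Rm^T = Rm).
Context (V : 'cV[R]_n -> R).
Hypothesis hV1 : continuously_differentiable V.
Hypothesis hVconv : convex_function [set: convex_lmodType 'cV[R]_n] V.

Local Notation f := (drift Sg).
Local Notation G := (inmx Sg).
Local Notation h := (outmap Sg).
Local Notation J := (feedmx Sg).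

(* The gap between the supply rate and the storage derivative is the quadratic
   polynomial [gap0 + 2 gap1 v + v^T gap2 v] in [v = u - k_u xb]. *)
Definition gap0 x xb : R :=
  quad Q (h x - h xb) - dot (gradient V x - gradient V xb) (f x - f xb).
Definition gap1 x xb : 'cV[R]_m :=
  (Q *m J + S)^T *m (h x - h xb) -
  2^-1 *: (G^T *m (gradient V x - gradient V xb)).
Definition gap2 : 'M[R]_m := Rm + J^T *m S + S^T *m J + J^T *m Q *m J.

Lemma gap2_tr : gap2^T = gap2.
Proof.
by rewrite /gap2 !linearD/= !trmx_mul !trmxK hQ hR mulmxA -!addrA (addrCA (_ *m S)).
Qed.

(** The two arguments separate: [gap1 s t] is [b s - b t] for a single function [b]. *)
Lemma gap1B x y z : gap1 x y = gap1 x z - gap1 y z.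
Proof.
pose b x := (Q *m J + S)^T *m h x - 2^-1 *: (G^T *m gradient V x).
suff gap1E s t : gap1 s t = b s - b t.
  by rewrite !gap1E; move: (b x) (b y) (b z) => *; rewrite opprB addrA subrK.
by rewrite /gap1 /b !mulmxBr scalerBr !opprD !opprK addrACA.
Qed.

(** At an equilibrium [- f xb] lies in the range of [G], where [(G^T G)^-1 G^T] recovers the
    input. *)
Lemma k_uP xb : equilibria Sg xb -> f xb + G *m k_u Sg xb = 0.
Proof.
move=> [ub /eqP]; rewrite addr_eq0 => /eqP fE.
have [_ _ rkG _ _] := hSg.
by rewrite /k_u fE !mulmxN opprK -!mulmxA (mulmxA G^T) mulKmx ?addNr// gram_unitmx.
Qed.

Lemma supply_gapE x xb v : equilibria Sg xb ->
  supply Q S Rm v (output Sg x (k_u Sg xb + v) - k_y Sg xb) -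
  dot (gradient (bregman V xb) x) (vfield Sg x (k_u Sg xb + v)) =
  gap0 x xb + 2 * dot (gap1 x xb) v + quad gap2 v.
Proof.
move=> Exb; rewrite (gradient_bregman _ (hV1.1 x)).
have -> : output Sg x (k_u Sg xb + v) - k_y Sg xb = h x - h xb + J *m v.
  by rewrite /output /k_y mulmxDr; apply/colP => i; rewrite !mxE; ring.
have -> : vfield Sg x (k_u Sg xb + v) = f x - f xb + G *m v.
  have /eqP := k_uP Exb; rewrite addrC addr_eq0 => /eqP fE.
  by rewrite /vfield mulmxDr fE addrA.
rewrite /supply /supply_mx quad_block /gap0 /gap1 /gap2.
move: (h x - h xb) (gradient V x - _) (f x - f xb) => y g w.
(* Symmetry of [Q] merges the two cross terms between [y] and [J v]. *)
have QyJ : dot (J *m v) (Q *m y) = dot y (Q *m (J *m v)).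
  by rewrite dotC [RHS]dot_mulmxr hQ.
have trP k l (A : 'M[R]_(k, l)) a b : dot a (A^T *m b) = dot (A *m a) b.
  by rewrite dot_mulmxr trmxK.
rewrite !quadE !(dotDl, dotNl, dotZl) -!dot_mulmxr.
rewrite !(mulmxDl, mulmxDr, dotDr, dotDl) -!mulmxA !trP QyJ [dot (S *m v) _]dotC.
by field.
Qed.

Lemma EID_gap_ge0 : EID Sg (supply Q S Rm) (bregman V) <->
  forall x xb v, equilibria Sg xb ->
    0 <= gap0 x xb + 2 * dot (gap1 x xb) v + quad gap2 v.
Proof.
have [_ _ _ _ [fwd _]] := hSg.
split=> [eid x0 xb v Exb|gap_ge0 xb Exb].
  (* Forward completeness supplies a trajectory from [x0] under this constant input; the dissipation
     inequality is read at time 0. *)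
  pose u0 := k_u Sg xb + v.
  have [x [trx x0E]] := fwd x0 (fun=> u0) (L2e_cst u0).
  have [_ _ _ /(_ _ x (L2e_cst u0) trx 0 (lexx 0))] := eid xb Exb.
  by rewrite -supply_gapE// x0E /u0 [_ + v - _]addrAC subrr add0r subr_ge0.
split=> [x||| u x _ _ t _].
- exact: bregman_ge0 (hV1.1 xb) hVconv.
- exact: bregman_continuously_differentiable.
- by rewrite /bregman !subrr dot0r subr0.
have := gap_ge0 (x t) xb (u t - k_u Sg xb) Exb.
by rewrite -supply_gapE// subr_ge0 [_ + (u t - _)]addrC subrK.
Qed.

(** After transposing the second equation, the three conditions match the coefficients of
    [|ell + W v|^2]. *)
Lemma EID_equationsE k (W : 'M[R]_(k, m)) ell :
  EID_equations Sg Q S Rm V W ell <->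
  forall x xb, equilibria Sg xb ->
    [/\ gap0 x xb = sqnorm2 (ell x xb), gap1 x xb = W^T *m ell x xb
      & W^T *m W = gap2].
Proof.
suff eqE x xb :
    [/\ gap0 x xb = sqnorm2 (ell x xb), gap1 x xb = W^T *m ell x xb
      & W^T *m W = gap2] <->
    [/\ dot (gradient V x - gradient V xb) (f x - f xb) =
          quad Q (h x - h xb) - sqnorm2 (ell x xb),
        2^-1 *: ((gradient V x - gradient V xb)^T *m G) =
          (h x - h xb)^T *m (Q *m J + S) - (ell x xb)^T *m W
      & W^T *m W = gap2].
  rewrite /EID_equations/=; split=> H x xb Exb; last by apply/eqE/H.
  by apply/eqE; exact: H.
rewrite /gap0 /gap1; move: (_ - gradient V xb) (h x - h xb) => g y.
have trg : (G^T *m g)^T = g^T *m G by rewrite trmx_mul trmxK.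
split=> -[e0 e1 e2]; split=> //.
- by rewrite -e0 subKr.
- apply: trmx_inj; rewrite linearZ/= -trg trmxK linearB/= !trmx_mul !trmxK -e1.
  by rewrite subKr.
- by rewrite e0 subKr.
- by apply: trmx_inj; rewrite linearB/= linearZ/= trg e1 !trmx_mul !trmxK subKr.
Qed.

(** The extra row of [W] is zero, so the last entry of [ell] can absorb the slack in the first
    equation alone; it also keeps the row count positive when [m = 0]. *)
Lemma gap_ge0_equations :
  (forall x xb v, equilibria Sg xb ->
    0 <= gap0 x xb + 2 * dot (gap1 x xb) v + quad gap2 v) ->
  exists (W : 'M[R]_(m + 1, m)) ell, EID_equations Sg Q S Rm V W ell.
Proof.
move=> gap_ge0.
have [[x0 Ex0]|noE] := pselect (exists x0, equilibria Sg x0); last first.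
  exists 0, (fun _ _ => 0); apply/EID_equationsE => x xb Exb.
  by case: noE; exists xb.
(* On the diagonal [gap0] and [gap1] vanish, so one equilibrium suffices to make [gap2] positive
   semidefinite. *)
have [W WE] : exists W : 'M[R]_m, W^T *m W = gap2.
  apply: psd_factorization gap2_tr _ => v.
  have := gap_ge0 x0 x0 v Ex0.
  rewrite /gap0 /gap1 !subrr !mulmx0 scaler0 subr0 quadE mulmx0 !dot0l.
  by rewrite subrr mulr0 !add0r.
have /choice[z zP] (xy : 'cV[R]_n * 'cV[R]_n) : exists z, equilibria Sg xy.2 ->
    gap2 *m z = gap1 xy.1 xy.2 /\ dot (gap1 xy.1 xy.2) z <= gap0 xy.1 xy.2.
  have [Exb|?] := pselect (equilibria Sg xy.2); last by exists 0.
  have [z zP] := quad_poly_ge0 gap2_tr (fun v => gap_ge0 xy.1 xy.2 v Exb).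
  by exists z.
pose rest x xb := gap0 x xb - dot (gap1 x xb) (z (x, xb)).
exists (col_mx W 0), (fun x xb => col_mx (W *m z (x, xb)) (Num.sqrt (rest x xb))%:M).
apply/EID_equationsE => x xb Exb; have [/= gz z_le] := zP (x, xb) Exb.
rewrite !tr_col_mx !mul_row_col trmx0 !mul0mx !addr0 mulmxA WE gz; split=> //.
rewrite /sqnorm2 dot_col_mx -/(sqnorm2 _) -quad_tr_mul WE quadE gz.
rewrite [dot _%:M _]dotE big_ord1 mxE eqxx mulr1n -expr2 sqr_sqrtr ?subr_ge0//.
by rewrite /rest dotC addrC subrK.
Qed.

(** The polynomial is the square [|ell + W v|^2]. *)
Lemma equations_gap_ge0 k (W : 'M[R]_(k, m)) ell :
  EID_equations Sg Q S Rm V W ell -> forall x xb v, equilibria Sg xb ->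
  0 <= gap0 x xb + 2 * dot (gap1 x xb) v + quad gap2 v.
Proof.
move=> /EID_equationsE eqs x xb v Exb; have [-> -> <-] := eqs x xb Exb.
have := sqnorm2_ge0 (ell x xb + W *m v); rewrite quad_tr_mul -dot_mulmxr.
by rewrite /sqnorm2 !(dotDl, dotDr) (dotC (W *m v) (ell _ _)); lra.
Qed.

(* With a base equilibrium [x0], take [l x := ell x x0]: since [gap1] is a
   coboundary, [ell x xb - l x + l xb] lies in the kernel of [W^T]. *)
Lemma EID_equations_normal_form k (W : 'M[R]_(k, m)) ell :
  EID_equations Sg Q S Rm V W ell ->
  exists (l : 'cV[R]_n -> 'cV[R]_k)
         (T : 'M[R]_(k, \dim (ker_trmx W)))
         (q : 'cV[R]_n -> 'cV[R]_n -> 'cV[R]_(\dim (ker_trmx W))),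
    [/\ columns_basis (ker_trmx W) T,
        forall x, q x x = 0
      & EID_equations Sg Q S Rm V W (fun x xb => l x - l xb + T *m q x xb)].
Proof.
move=> /EID_equationsE eqs; have [T bT] := columns_basis_exists (ker_trmx W).
have [[x0 Ex0]|noE] := pselect (exists x0, equilibria Sg x0); last first.
  exists (fun=> 0), T, (fun _ _ => 0); split=> //.
  by apply/EID_equationsE => x xb Exb; case: noE; exists xb.
pose l x := ell x x0.
have /choice[q qP] (xy : 'cV[R]_n * 'cV[R]_n) : exists c, equilibria Sg xy.2 ->
    ell xy.1 xy.2 - (l xy.1 - l xy.2) = T *m c.
  have [Exb|?] := pselect (equilibria Sg xy.2); last by exists 0.
  have [|c cE] := columns_basis_mulP (v := ell xy.1 xy.2 - (l xy.1 - l xy.2)) bT.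
    rewrite /ker_trmx memv_ker lfunE/= !mulmxBr.
    have [_ <- _] := eqs xy.1 xy.2 Exb; have [_ <- _] := eqs xy.1 x0 Ex0.
    by have [_ <- _] := eqs xy.2 x0 Ex0; rewrite (gap1B _ _ x0) subrr.
  by exists c.
(* This makes overwriting [q] by 0 on the diagonal compatible with the equations. *)
have ell0 x : equilibria Sg x -> ell x x = 0.
  move=> Ex; have [e0 _ _] := eqs x x Ex; apply/eqP.
  by rewrite -sqnorm2_eq0 -e0 /gap0 !subrr quadE mulmx0 !dot0r subrr.
(* The chosen [q] is not determined at non-equilibria, and [q x x = 0] is required at every [x],
   hence the case split. *)
exists l, T, (fun x xb => if x == xb then 0 else q (x, xb)); split=> // [x|].
  by rewrite eqxx.
apply/EID_equationsE => x xb Exb.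
suff -> : l x - l xb + T *m (if x == xb then 0 else q (x, xb)) = ell x xb.
  exact: eqs.
have [->|_] := eqVneq; first by rewrite subrr mulmx0 addr0 ell0.
by rewrite -(qP (x, xb))//= addrC subrK.
Qed.

End Dissipativity.

Theorem lemma3p4 (R : realType) (n m p : nat) (Sg : affine_system R n m p)
    (hSg : standing_assumptions Sg)
    (Q : 'M[R]_p) (S : 'M[R]_(p, m)) (Rm : 'M[R]_m)
    (hQ : Q^T = Q) (hR : Rm^T = Rm)
    (hind : sign_indefinite (supply_mx Q S Rm))
    (V : 'cV[R]_n -> R)
    (hV0 : forall x, 0 <= V x)
    (hV1 : continuously_differentiable V)
    (hVconv : convex_function [set: convex_lmodType 'cV[R]_n] V) :
  (EID Sg (supply Q S Rm) (bregman V) <->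
   exists (k : nat) (W : 'M[R]_(k, m))
          (ell : 'cV[R]_n -> 'cV[R]_n -> 'cV[R]_k),
     (0 < k)%N /\ EID_equations Sg Q S Rm V W ell) /\
  (forall (k : nat) (W : 'M[R]_(k, m)), (0 < k)%N ->
   (exists ell : 'cV[R]_n -> 'cV[R]_n -> 'cV[R]_k,
      EID_equations Sg Q S Rm V W ell) ->
   exists (l : 'cV[R]_n -> 'cV[R]_k)
          (T : 'M[R]_(k, \dim (ker_trmx W)))
          (q : 'cV[R]_n -> 'cV[R]_n -> 'cV[R]_(\dim (ker_trmx W))),
     [/\ columns_basis (ker_trmx W) T,
         forall x, q x x = 0
       & EID_equations Sg Q S Rm V W
           (fun x xb => l x - l xb + T *m q x xb)]).
Proof.
have gapP := EID_gap_ge0 hSg S Rm hQ hV1 hVconv.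
split=> [|k W _ [ell /EID_equations_normal_form]//].
split=> [/gapP /gap_ge0_equations-/(_ hQ hR)[W [ell eqs]]|].
  by exists (m + 1)%N, W, ell; split=> //; rewrite addn1.
by move=> [k [W [ell [_ /equations_gap_ge0 gap_ge0]]]]; apply/gapP.
Qed.
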